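(* For a graph $G$ and an integer $p\ge 1$, the following conditions are equivalent: (1) $\mathrm{Med}^{p}_{\mathrm{loc}}(\pi)=\mathrm{Med}(\pi)$ for any integer profile $\pi$; (2) $\mathrm{Med}^{p}_{\mathrm{loc}}(\pi)=\mathrm{Med}(\pi)$ for any profile $\pi$; (3) $F_\pi$ is $p$-weakly convex for any profile $\pi$; (4) $F_\pi$ is $p$-weakly peakless for any profile $\pi$; (5) for every profile $\pi$, all level sets $\{x: F_\pi(x)\le\alpha\}$ $(\alpha\in\mathbb{R})$ of $F_\pi$ are $p$-isometric; (6) all median sets $\mathrm{Med}(\pi)$ are $p$-isometric; (7) all median sets $\mathrm{Med}(\pi)$ are connected in $G^p$, i.e., induce connected subgraphs of $G^p$.
   Context: Graphs are undirected, connected, without loops or multiple edges, and not necessarily finite. $d$ is the standard graph distance of $G=(V,E)$. $I(u,v)=\{w: d(u,w)+d(w,v)=d(u,v)\}$ and $I^{\circ}(u,v)=I(u,v)\setminus\{u,v\}$. The $p$th power $G^p$ has vertex set $V$, and distinct $u,v$ are adjacent in $G^p$ iff $d(u,v)\le p$. A profile is a map $\pi:V\to[0,\infty)$ with finite support. It is an integer profile if $\pi(v)\in\mathbb{N}$ for all $v$. The median function is $F_\pi(x)=\sum_{u:\pi(u)>0}\pi(u)d(u,x)$, and $\mathrm{Med}(\pi)$ is the set of vertices minimizing $F_\pi$ over $V$. $\mathrm{Med}^{p}_{\mathrm{loc}}(\pi)$ is the set of vertices $x$ with $F_\pi(x)\le F_\pi(y)$ for all $y$ with $d(x,y)\le p$.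 A geodesic string is a finite sequence $P=(u=w_0,\ldots,w_n=v)$ of vertices occurring in this order on some shortest $(u,v)$-path of $G$. A $p$-geodesic is a geodesic string with $d(w_i,w_{i+1})\le p$ for all $0\le i\le n-1$. A function $f:V\to\mathbb{R}$ is convex on $P$ if $f(w_j)\le \frac{d(w_k,w_j)}{d(w_i,w_k)} f(w_i)+\frac{d(w_i,w_j)}{d(w_i,w_k)} f(w_k)$ for all $i<j<k$. It is peakless on $P$ if $i<j<k$ implies $f(w_j)\le\max\{f(w_i),f(w_k)\}$, with equality only if $f(w_i)=f(w_j)=f(w_k)$. A function $f$ is $p$-weakly convex (respectively $p$-weakly peakless) if any two vertices can be connected by a $p$-geodesic along which $f$ is convex (respectively peakless). A set $S\subseteq V$ is $p$-isometric if for any $u,v\in S$ with $d(u,v)\ge p+1$ there exists a vertex $w\in I^{\circ}(u,v)\cap S$. *)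

(* Defs.v *)
From HB Require Import structures.
From mathcomp Require Import all_boot all_order all_algebra.
From mathcomp Require Import all_classical all_reals.

Set Implicit Arguments.
Unset Strict Implicit.
Unset Printing Implicit Defensive.

Import Order.TTheory GRing.Theory Num.Theory.
Local Open Scope classical_set_scope.
Local Open Scope ring_scope.

(* [S] induces a connected subgraph of the graph with edge relation [e]. *)
Definition connected_in (V : choiceType) (e : rel V) (S : set V) : Prop :=
  forall x y, S x -> S y ->
    exists s : seq V,
      [/\ path e x s, last x s = y & forall z, z \in s -> S z].

(* Possibly infinite; a [choiceType] of vertices is no restriction, since
   classically every type carries a choice structure. *)
Record connected_graph := ConnectedGraph {
  vertex :> choiceType;
  adj : rel vertex;
  adj_sym : symmetric adj;
  adj_irr : irreflexive adj;
  adj_connected : connected_in adj [set: vertex]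
}.

Section Distance.
Variable G : connected_graph.
Implicit Types (u v w x y : G) (s q P : seq G).

Definition has_walk x y (n : nat) : bool :=
  `[< exists s, [/\ path (@adj G) x s, last x s = y & size s = n] >].

Lemma has_walk_ex x y : exists n, has_walk x y n.
Proof.
have [s [ps ls _]] := @adj_connected G x y I I.
by exists (size s); apply/asboolP; exists s.
Qed.

Definition gdist x y : nat := ex_minn (has_walk_ex x y).

Definition geo_interval u v : set G :=
  [set w | (gdist u w + gdist w v = gdist u v)%N].

Definition open_interval u v : set G := geo_interval u v `\` [set u; v].

Definition power_adj (p : nat) : rel G :=
  [rel u v | (u != v) && (gdist u v <= p)%N].

(* The path is [u :: s]. *)
Definition shortest_path u v s : Prop :=
  [/\ path (@adj G) u s, last u s = v & size s = gdist u v].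

(* The string is [u :: q]. Using [subseq] makes its vertices pairwise distinct,
   so that the quotients of distances in [convex_on] have nonzero
   denominators. *)
Definition geodesic_string u v q : Prop :=
  last u q = v /\ exists s, shortest_path u v s /\ subseq (u :: q) (u :: s).

Definition p_geodesic (p : nat) u v q : Prop :=
  geodesic_string u v q /\ path [rel x y | (gdist x y <= p)%N] u q.

Definition p_isometric (p : nat) (S : set G) : Prop :=
  forall u v, S u -> S v -> (p.+1 <= gdist u v)%N ->
    exists w, (open_interval u v `&` S) w.

End Distance.

Section Functions.
Variables (R : realType) (G : connected_graph).
Implicit Types (f pi : G -> R) (p : nat) (u v x y : G) (q : seq G).

(* Convexity of [f] on the string [u :: q]. *)
Definition convex_on f u q : Prop :=
  let w := nth u (u :: q) in
  forall i j k : nat, (i < j)%N -> (j < k)%N -> (k < size (u :: q))%N ->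
    f (w j) <=
      (gdist (w k) (w j))%:R / (gdist (w i) (w k))%:R * f (w i) +
      (gdist (w i) (w j))%:R / (gdist (w i) (w k))%:R * f (w k).

(* Peaklessness of [f] on the string [u :: q]. *)
Definition peakless_on f u q : Prop :=
  let w := nth u (u :: q) in
  forall i j k : nat, (i < j)%N -> (j < k)%N -> (k < size (u :: q))%N ->
    f (w j) <= Num.max (f (w i)) (f (w k)) /\
    (f (w j) = Num.max (f (w i)) (f (w k)) ->
       f (w i) = f (w j) /\ f (w j) = f (w k)).

Definition weakly_convex p f : Prop :=
  forall u v, exists q, p_geodesic p u v q /\ convex_on f u q.

Definition weakly_peakless p f : Prop :=
  forall u v, exists q, p_geodesic p u v q /\ peakless_on f u q.

Definition profile pi : Prop :=
  (forall v, 0 <= pi v) /\ finite_set [set v | pi v != 0].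

Definition integer_profile pi : Prop :=
  profile pi /\ forall v, pi v \is a Num.nat.

Definition median_fun pi x : R :=
  \sum_(u \in [set u | 0 < pi u]) pi u * (gdist u x)%:R.

Definition Med pi : set G :=
  [set x | forall y, median_fun pi x <= median_fun pi y].

Definition Med_loc p pi : set G :=
  [set x | forall y, (gdist x y <= p)%N -> median_fun pi x <= median_fun pi y].

Definition level_set f (alpha : R) : set G := [set x | f x <= alpha].

End Functions.

(* Main.v *)
Require Import Defs.
From HB Require Import structures.
From mathcomp Require Import all_boot all_order all_algebra.
From mathcomp Require Import all_classical all_reals.
From mathcomp Require Import zify ring lra.

(** From weak convexity to connected median sets the implications are formal: a
convex function is peakless, a level set of a peakless function contains a vertex
strictly between any two of its far away points, median sets are level sets, and
a p-isometric set is connected in the p-th power by induction on the distance.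
Two steps carry the content, and both work by placing extra masses.

Connected median sets make local medians global ([Med_loc_eq_of_connected]).  If
[x] is a local but not a global median of [pi], put an additional mass [mu] at
[x].  This penalizes every other vertex in proportion to its distance from [x].
For the least [mu] that makes [x] a median, some other vertex is a median too;
but since [mu > 0] and [x] was a local median, no other vertex within distance
[p] of [x] is one.  So [x] is isolated in a disconnected median set.

If local medians of integer profiles are global, then all median functions are
p-weakly convex ([weakly_convex_of_local]).  Fix [u] and [v] at distance
[n > p], and let [w] minimize, over the open interval, the height of the median
function above the chord that joins its values at [u] and [v].
- The height at [w] is at most 0.  Otherwise all heights over the open interval
  are bounded below by a positive number, so scaling and rounding give an
  integer profile whose heights are as large as desired
  ([integer_profile_chord_gap]).  Masses at [u] and [v] change the median
  function by an affine function of the position inside the interval, hence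
  leave the heights unchanged.  Huge masses keep the outside of the interval
  expensive, and their difference can be adjusted so that the value at [v] is
  just below the value at [u].  Then [u] is a local but not a global median
  ([local_median_of_chord_gap]).
- By induction on the distance there are convex p-geodesics from [u] to [w] and
  from [w] to [v].  Their concatenation is convex because the height is minimal
  at the junction [w] ([weakly_convex_of_min]).

The graph may be infinite, so the minima above need a reason to exist: the
median function depends only on the distances to finitely many vertices, and on
a bounded set these distances take finitely many values ([attains_min]). *)

Set Implicit Arguments.
Unset Strict Implicit.
Unset Printing Implicit Defensive.

Import Order.TTheory GRing.Theory Num.Theory.

(** * Distances and geodesics *)

Section Metric.
Variable G : connected_graph.
Implicit Types (u v w x y z : G) (s q : seq G).

Lemma shortest_path_ex x y : exists s, shortest_path x y s.
Proof. by rewrite /shortest_path /gdist; case: ex_minnP => n /asboolP. Qed.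

Lemma gdist_le_size x s : path (@adj G) x s -> gdist x (last x s) <= size s.
Proof.
move=> ps; rewrite /gdist; case: ex_minnP => n _; apply.
by apply/asboolP; exists s.
Qed.

Lemma gdistxx x : gdist x x = 0.
Proof. by apply/eqP; rewrite -leqn0 -{2}[x]/(last x [::]) gdist_le_size. Qed.

Lemma gdist_eq0 x y : (gdist x y == 0) = (x == y).
Proof.
apply/eqP/eqP => [d0|->]; last exact: gdistxx.
by have [s [_ ls]] := shortest_path_ex x y; rewrite d0 -ls => /size0nil->.
Qed.

Lemma gdist_gt0 x y : (0 < gdist x y) = (x != y).
Proof. by rewrite lt0n gdist_eq0. Qed.

Lemma gdist_triangle y x z : gdist x z <= gdist x y + gdist y z.
Proof.
have [s [ps ls <-]] := shortest_path_ex x y.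
have [t [pt lt <-]] := shortest_path_ex y z.
rewrite -size_cat -lt -ls -last_cat; apply: gdist_le_size.
by rewrite cat_path ps ls.
Qed.

Lemma gdist_sym x y : gdist x y = gdist y x.
Proof.
suff le_sym (a b : G) : gdist b a <= gdist a b.
  by apply/eqP; rewrite eqn_leq !le_sym.
have [s [ps ls <-]] := shortest_path_ex a b.
have lr : last b (rev (belast a s)) = a.
  by case: s ls {ps} => [|c s] //= _; rewrite rev_cons last_rcons.
rewrite -[size s](size_belast a) -size_rev -{1}lr; apply: gdist_le_size.
rewrite -ls rev_path; under eq_path do rewrite adj_sym.
exact: ps.
Qed.

Lemma open_intervalP u v x :
  open_interval u v x <->
  [/\ gdist u x + gdist x v = gdist u v, 0 < gdist u x & 0 < gdist x v].
Proof.
rewrite !gdist_gt0; split.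
  move=> [xuv /= xNuv]; split=> //; apply/eqP => xE; apply: xNuv;
  by [left | right].
by move=> [xuv ux xv]; split=> // -[] /= xE; rewrite xE eqxx in ux xv.
Qed.

Lemma geo_interval_cases u v x : gdist u x + gdist x v = gdist u v ->
  [\/ x = u, x = v | open_interval u v x].
Proof.
move=> xuv; have [->|xu] := eqVneq x u; first by constructor 1.
have [->|xv] := eqVneq x v; first by constructor 2.
by constructor 3; apply/open_intervalP; rewrite xuv !gdist_gt0 eq_sym xu.
Qed.

Lemma gdist_nth_path u s i j : path (@adj G) u s -> i <= j <= size s ->
  gdist (nth u (u :: s) i) (nth u (u :: s) j) <= j - i.
Proof.
elim: s u i j => [|a s IHs] u i j /=.
  by move=> _ /andP[]; case: j i => [|//] [|//]; rewrite gdistxx.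
move=> /andP[ua ps]; case: i j => [|i] [|j] //=; rewrite ?gdistxx// !ltnS => ij.
  have := IHs a 0 j ps ij; rewrite subn0 /= => le_j.
  have := @gdist_le_size u [:: a]; rewrite /= andbT => /(_ ua) le1.
  rewrite (set_nth_default a) //=.
  have := gdist_triangle a u (nth a (a :: s) j).
  lia.
rewrite !(@set_nth_default _ (a :: s) a u) /=; [|lia..].
by rewrite subSS IHs.
Qed.

(** The three pieces into which [nth i] and [nth j] cut the walk have at most
their combinatorial lengths, and these add up to the distance of the ends. *)
Lemma gdist_nth_shortest u v s i j : shortest_path u v s -> i <= j <= size s ->
  gdist (nth u (u :: s) i) (nth u (u :: s) j) = j - i.
Proof.
move=> [ps ls ss] ij; apply/eqP; rewrite eqn_leq gdist_nth_path//=.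
have le_i : gdist u (nth u (u :: s) i) <= i.
  by have := @gdist_nth_path u s 0 i ps; rewrite subn0; apply; lia.
have le_j : gdist (nth u (u :: s) j) v <= size s - j.
  have := @gdist_nth_path u s j (size s) ps.
  by rewrite -last_nth ls; apply; lia.
have := gdist_triangle (nth u (u :: s) i) u v.
have := gdist_triangle (nth u (u :: s) j) (nth u (u :: s) i) v.
lia.
Qed.

(** Being in order on a geodesic from [u] is a relation between two vertices, so
it passes from the path to any subsequence of it. *)
Lemma geodesic_string_nth u v q i j : geodesic_string u v q ->
  i < j < size (u :: q) ->
  let w := nth u (u :: q) in
  gdist u (w i) + gdist (w i) (w j) = gdist u (w j) /\ 0 < gdist (w i) (w j).
Proof.
move=> [lq [s [sp sub]]] /andP[ij jq] w.
pose r x y := (gdist u x + gdist x y == gdist u y) && (0 < gdist x y).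
have prw : pairwise r (u :: q).
  apply: (subseq_pairwise sub).
  apply/(pairwiseP u) => k l /=; rewrite !inE !ltnS => ks ls kl.
  have d0 m : m <= size s -> gdist u (nth u (u :: s) m) = m.
    by move=> ms; rewrite (gdist_nth_shortest (i := 0) sp) ?subn0.
  rewrite /r !d0// (gdist_nth_shortest sp); last by rewrite ltnW.
  by rewrite subnKC ?(ltnW kl)// eqxx subn_gt0.
have /(pairwiseP u)/(_ i j (ltn_trans ij jq) jq ij) := prw.
by move=> /andP[/eqP].
Qed.

Lemma nth_geodesic_last u v q : geodesic_string u v q ->
  nth u (u :: q) (size q) = v.
Proof. by move=> [<- _]; rewrite -last_nth. Qed.

Lemma geodesic_string_interval u v q i : geodesic_string u v q ->
  i < size (u :: q) ->
  gdist u (nth u (u :: q) i) + gdist (nth u (u :: q) i) v = gdist u v.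
Proof.
move=> gs; rewrite ltnS leq_eqVlt => /predU1P[->|iq].
  by rewrite (nth_geodesic_last gs) gdistxx addn0.
have [] := geodesic_string_nth gs (i := i) (j := size q).
  by rewrite iq /=.
by rewrite (nth_geodesic_last gs).
Qed.

Lemma geodesic_string_cat u w v q1 q2 :
  gdist u w + gdist w v = gdist u v ->
  geodesic_string u w q1 -> geodesic_string w v q2 ->
  geodesic_string u v (q1 ++ q2).
Proof.
move=> wuv [l1 [s1 [[ps1 ls1 ss1] sub1]]] [l2 [s2 [[ps2 ls2 ss2] sub2]]].
split; first by rewrite last_cat l1.
exists (s1 ++ s2); split; first split.
- by rewrite cat_path ps1 ls1.
- by rewrite last_cat ls1.
- by rewrite size_cat ss1 ss2.
by rewrite -!cat_cons cat_subseq //; move: sub2; rewrite /= eqxx.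
Qed.

Lemma p_geodesic_cat p u w v q1 q2 :
  gdist u w + gdist w v = gdist u v ->
  p_geodesic p u w q1 -> p_geodesic p w v q2 -> p_geodesic p u v (q1 ++ q2).
Proof.
move=> wuv [g1 p1] [g2 p2]; split; first exact: geodesic_string_cat g1 g2.
by rewrite cat_path p1; case: g1 => ->.
Qed.

Lemma p_geodesic_short p u v : gdist u v <= p ->
  exists q, p_geodesic p u v q /\ size q <= 1.
Proof.
move=> uvp; have [s sp] := shortest_path_ex u v.
have [uv|uv] := eqVneq u v.
  exists [::]; split=> //; split=> //; split=> //; exists s; split => //.
  by rewrite /= eqxx sub0seq.
exists [:: v]; split=> //; split; last by rewrite /= uvp.
split=> //; exists s; split => //=; rewrite eqxx sub1seq.
case: sp uv; case: s => [|a s] /= _ <-; first by rewrite eqxx.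
by rewrite mem_last.
Qed.

Lemma open_interval_nonempty u v : 1 < gdist u v ->
  exists x, open_interval u v x.
Proof.
have [s sp] := shortest_path_ex u v; case: (sp) => _ ls <- s1.
exists (nth u (u :: s) 1); apply/open_intervalP.
have := gdist_nth_shortest (i := 0) (j := 1) sp.
have := gdist_nth_shortest (i := 1) (j := size s) sp.
rewrite -last_nth ls /= => -> //; last lia.
move=> ->; last lia.
by case: sp => _ _ <-; split; lia.
Qed.

Lemma p_geodesic_interior p u v q : p_geodesic p u v q -> p < gdist u v ->
  exists j, 0 < j < size q /\ open_interval u v (nth u (u :: q) j).
Proof.
move=> [gs pq] puv; have q1 : 1 < size q.
  case: q gs pq => [|a [|b q]] //= [] /= lq _.
    by move: puv; rewrite lq gdistxx.
  by rewrite andbT lq leqNgt puv.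
exists 1; split=> //; apply/open_intervalP.
have [_] := geodesic_string_nth gs (i := 0) (j := 1) (ltnW q1).
have [|_] := geodesic_string_nth gs (i := 1) (j := size q).
  by rewrite q1 /=.
rewrite (nth_geodesic_last gs) /= => -> ->.
by split=> //; apply: (geodesic_string_interval gs (i := 1)) => /=; lia.
Qed.

(** Split at a vertex of [S] strictly between two far away vertices of [S]; both
parts are shorter. *)
Lemma p_isometric_connected p (S : set G) : 0 < p -> p_isometric p S ->
  connected_in (@power_adj G p) S.
Proof.
move=> p0 pS x y; have [n] := ubnP (gdist x y).
elim: n x y => // n IHn x y xyn Sx Sy.
have [xyp|pxy] := leqP (gdist x y) p.
  have [->|xy] := eqVneq x y; first by exists [::].
  exists [:: y]; split=> //=; first by rewrite /power_adj /= xy xyp.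
  by move=> z; rewrite inE => /eqP->.
have [w [/open_intervalP[wxy xw wy] Sw]] := pS x y Sx Sy pxy.
have [|s [ps ls Ss]] := IHn x w _ Sx Sw; first lia.
have [|t [pt lt St]] := IHn w y _ Sw Sy; first lia.
exists (s ++ t); split; first by rewrite cat_path ps ls.
  by rewrite last_cat ls.
by move=> z; rewrite mem_cat => /orP[/Ss|/St].
Qed.

(** A function of the distances to finitely many vertices takes only finitely
many values on a bounded set, even when that set is infinite.  The proof encodes
a vertex of [S] by its distance vector, which lives in a finite type. *)
Lemma attains_min (R : realType) (s : seq G) (g : G -> R) (S : set G) x0 B :
  (forall x y, (forall z, z \in s -> gdist z x = gdist z y) -> g x = g y) ->
  (forall x, S x -> gdist x0 x <= B) -> (exists x, S x) ->
  exists2 m, S m & forall x, S x -> (g m <= g x)%R.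
Proof.
move=> gE SB [x1 Sx1].
pose C := \max_(z <- s) gdist z x0 + B.
have dC x z : S x -> z \in s -> gdist z x < C.+1.
  move=> /SB xB zs; have := gdist_triangle x0 z x.
  have := @leq_bigmax_seq _ s predT (fun z => gdist z x0) z zs isT.
  by rewrite /C /=; lia.
pose code x := [ffun i : 'I_(size s) => inord (gdist (nth x0 s i) x) : 'I_C.+1].
have codeE x y : S x -> S y -> code x = code y -> g x = g y.
  move=> Sx Sy /ffunP xy; apply: gE => z zs.
  have zi : index z s < size s by rewrite index_mem.
  have := congr1 val (xy (Ordinal zi)).
  by rewrite !ffunE /= !inordK ?nth_index ?dC.
pose P c := `[< exists2 x, S x & code x = c >].
pose F c := if pselect (exists2 x, S x & code x = c) is left e
            then g (s2val (cid2 e)) else 0%R.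
have FE x : S x -> F (code x) = g x.
  move=> Sx; rewrite /F; case: pselect => [e|[]]; last by exists x.
  by case: (cid2 e) => y /= Sy yx; apply: codeE.
have P1 : P (code x1) by apply/asboolP; exists x1.
case: (arg_minP F P1) => c /asboolP[m Sm <-] minm.
exists m => // x Sx; rewrite -!FE //; apply: minm.
by apply/asboolP; exists x.
Qed.

End Metric.

(** * The median function *)

Section MedianFunction.
Local Open Scope classical_set_scope.
Local Open Scope ring_scope.
Variables (R : realType) (G : connected_graph).
Implicit Types (pi : G -> R) (u v w x y z : G) (s : seq G).

Lemma profile_support pi : profile pi ->
  exists2 s, uniq s & forall x, pi x != 0 -> x \in s.
Proof.
move=> [_ fin]; have /finite_seqP[s sE] := fin.
exists (undup s); first exact: undup_uniq.
move=> x pix; rewrite mem_undup.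
by have : [set v | pi v != 0] x by []; rewrite sE.
Qed.

(** Sums over different supports become comparable once they range over one
common list of vertices. *)
Lemma median_fun_seq pi s x : (forall y, 0 <= pi y) -> uniq s ->
  (forall y, pi y != 0 -> y \in s) ->
  median_fun pi x = \sum_(y <- s) pi y * (gdist y x)%:R.
Proof.
move=> pi0 us sup; rewrite (fsbig_seq _ _ us) /median_fun.
apply: fsbig_widen => y /=; first by move=> y0; rewrite sup // gt_eqF.
by case=> _; rewrite lt0r pi0 andbT => /negP/negPn/eqP->; rewrite mul0r.
Qed.

Lemma median_fun_ge0 pi x : profile pi -> 0 <= median_fun pi x.
Proof.
move=> pp; have [s us sup] := profile_support pp; case: pp => pi0 _.
by rewrite (median_fun_seq x pi0 us sup) sumr_ge0 // => y _; rewrite mulr_ge0.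
Qed.

Lemma le_median_fun pi x y : profile pi ->
  pi y * (gdist y x)%:R <= median_fun pi x.
Proof.
move=> pp; have [s us sup] := profile_support pp; have [pi0 _] := pp.
have [->|/sup ys] := eqVneq (pi y) 0.
  by rewrite mul0r median_fun_ge0.
rewrite (median_fun_seq x pi0 us sup) (bigD1_seq y) //= lerDl.
by rewrite sumr_ge0 // => z _; rewrite mulr_ge0.
Qed.

Lemma median_fun_local pi : profile pi ->
  exists s, forall x y, (forall z, z \in s -> gdist z x = gdist z y) ->
    median_fun pi x = median_fun pi y.
Proof.
move=> pp; have [s us sup] := profile_support pp; case: pp => pi0 _.
exists s => x y xy; rewrite !(median_fun_seq _ pi0 us sup).
by apply: eq_big_seq => z zs; rewrite xy.
Qed.

Definition add_mass pi v (a : R) : G -> R := fun x => pi x + a *+ (x == v).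

Lemma profile_add_mass pi v a : profile pi -> 0 <= a ->
  profile (add_mass pi v a).
Proof.
move=> pp a0; have [s us sup] := profile_support pp; case: pp => pi0 fin.
split=> [x|]; first by rewrite addr_ge0 // mulrn_wge0.
apply: (@sub_finite_set _ _ [set` v :: s]); last exact: finite_seq.
move=> x /=; apply: contraNT; rewrite inE negb_or => /andP[xv xs].
rewrite /add_mass (negbTE xv) mulr0n addr0.
by apply: contraNT xs => /sup.
Qed.

Lemma median_fun_add_mass pi v a x : profile pi -> 0 <= a ->
  median_fun (add_mass pi v a) x = median_fun pi x + a * (gdist v x)%:R.
Proof.
move=> pp a0; have [s us sup] := profile_support pp.
have [pi0 _] := pp; have [pi'0 _] := profile_add_mass v pp a0.
have us' := undup_uniq (v :: s).
have sup1 y : pi y != 0 -> y \in undup (v :: s).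
  by move=> /sup ys; rewrite mem_undup inE ys orbT.
have sup2 y : add_mass pi v a y != 0 -> y \in undup (v :: s).
  have [->|yv] := eqVneq y v; first by rewrite mem_undup mem_head.
  by rewrite /add_mass (negbTE yv) mulr0n addr0; exact: sup1.
rewrite (median_fun_seq x pi'0 us' sup2) (median_fun_seq x pi0 us' sup1).
have vs : v \in undup (v :: s) by rewrite mem_undup mem_head.
rewrite !(bigD1_seq v vs us') /= /add_mass eqxx mulr1n mulrDl addrAC.
congr (_ + _ + _).
by apply: eq_bigr => y /negbTE ->; rewrite mulr0n addr0.
Qed.

Definition round_profile (N : nat) pi : G -> R :=
  fun x => (Num.truncn (N%:R * pi x))%:R.

Lemma integer_round_profile N pi : profile pi ->
  integer_profile (round_profile N pi).
Proof.
move=> [pi0 fin]; split; last by move=> v; exact: natr_nat.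
split=> [v|]; first exact: ler0n.
apply: sub_finite_set fin => x /=; apply: contraNN => /eqP xx.
by rewrite /round_profile xx mulr0 truncn0.
Qed.

(** The rounding error at [x] is at most the sum of the distances from the
support of [pi] to [x], which is bounded on a ball independently of [N]. *)
Lemma median_fun_round pi x0 B : profile pi ->
  exists C : R, forall (N : nat) x, (gdist x0 x <= B)%N ->
    N%:R * median_fun pi x - C <= median_fun (round_profile N pi) x
                               <= N%:R * median_fun pi x.
Proof.
move=> pp; have [s us sup] := profile_support pp; have [pi0 _] := pp.
exists (\sum_(y <- s) (gdist y x0 + B)%:R) => N x xB.
have [[r0 _] _] := integer_round_profile N pp.
have supr y : round_profile N pi y != 0 -> y \in s.
  move=> yn0; apply: sup; apply: contraNN yn0 => /eqP yy.
  by rewrite /round_profile yy mulr0 truncn0.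
rewrite (median_fun_seq x pi0 us sup) (median_fun_seq x r0 us supr).
rewrite mulr_sumr -sumrB; apply/andP; split; apply: ler_sum => y _.
  have dle : (gdist y x)%:R <= (gdist y x0 + B)%:R :> R.
    by rewrite ler_nat; have := gdist_triangle x0 y x; lia.
  have /truncn_itv/andP[_] : 0 <= N%:R * pi y by rewrite mulr_ge0.
  rewrite -natr1 => lt1; rewrite /round_profile.
  have d0 : 0 <= (gdist y x)%:R :> R by [].
  nra.
by rewrite mulrA ler_wpM2r // truncn_le mulr_ge0.
Qed.

Lemma Med_sub_Med_loc p pi : (Med pi `<=` Med_loc p pi)%classic.
Proof. by move=> x xM y _; exact: xM. Qed.

(** With [m] a vertex of steepest descent seen from [x] and [mu] that slope, the
mass [mu] at [x] makes both [x] and [m] medians.  The first step from [x] to [m]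
in the median set leads to a vertex near [x] of smaller original value. *)
Lemma Med_loc_eq_of_connected p :
  (forall pi, profile pi -> connected_in (@power_adj G p) (Med pi)) ->
  forall pi, profile pi -> Med_loc p pi = Med pi.
Proof.
move=> conn pi pp; apply/seteqP; split; last exact: Med_sub_Med_loc.
move=> x xloc; apply: contrapT => xNM.
pose F := median_fun pi; pose S : set G := [set y | F y < F x].
have [y1 Sy1] : exists y, S y.
  apply: contrapT => Sn; apply: xNM => y; rewrite leNgt.
  by apply/negP => yx; apply: Sn; exists y.
have Sx y : S y -> 0 < (gdist x y)%:R :> R.
  move=> Sy; rewrite ltr0n gdist_gt0; apply: contraTneq Sy => ->.
  by rewrite /S /= ltxx.
(* A single vertex of positive mass makes [F y] large when it is far from
   [y]. *)
have [x0 [B SB]] : exists x0 B, forall y, S y -> (gdist x0 y <= B)%N.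
  have [x0 px0] : exists x0, 0 < pi x0.
    apply: contrapT => pi0; suff F0 y : F y = 0.
      by move: Sy1; rewrite /S /= !F0 ltxx.
    apply: fsbig1 => z /= z0; case: pi0; by exists z.
  exists x0, (Num.truncn (F x / pi x0)) => y Sy.
  rewrite truncn_ge_nat ?divr_ge0 ?median_fun_ge0 ?(ltW px0) //.
  rewrite ler_pdivlMr // mulrC; apply: le_trans (ltW Sy).
  exact: le_median_fun.
have [s sF] := median_fun_local pp.
pose g y := (F y - F x) / (gdist x y)%:R.
have gE y z : (forall t, t \in x :: s -> gdist t y = gdist t z) -> g y = g z.
  move=> yz; rewrite /g yz ?mem_head // /F (sF y z) // => t ts.
  by rewrite yz // inE ts orbT.
have [m Sm minm] := attains_min gE SB (ex_intro _ y1 Sy1).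
pose mu := - g m.
have mu0 : 0 < mu.
  by rewrite oppr_gt0 ltr_pdivrMr ?Sx // mul0r subr_lt0.
have pp' := profile_add_mass x pp (ltW mu0).
have FE y := median_fun_add_mass x y pp (ltW mu0).
have F'm : F m + mu * (gdist x m)%:R = F x.
  by rewrite /mu /g mulNr divfK ?gt_eqF ?Sx // opprB addrC subrK.
have F'ge y : F x <= F y + mu * (gdist x y)%:R.
  have [xy|yx] := leP (F x) (F y).
    by rewrite (le_trans xy) // lerDl mulr_ge0 // ltW.
  have := minm y yx; rewrite -[g m]opprK -/mu ler_pdivlMr ?Sx //; lra.
have Mx : Med (add_mass pi x mu) x.
  by move=> y; rewrite !FE gdistxx mulr0 addr0; exact: F'ge.
have Mm : Med (add_mass pi x mu) m.
  by move=> y; rewrite !FE F'm; exact: F'ge.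
have [[|z t] [/= pt lt tM]] := conn _ pp' x m Mx Mm.
  by move: (Sx m Sm); rewrite lt gdistxx ltxx.
have /(_ x) := tM z (mem_head _ _); rewrite !FE gdistxx mulr0 addr0.
case/andP: pt => /andP[xz xzp] _; have := xloc z xzp.
have : 0 < mu * (gdist x z)%:R by rewrite mulr_gt0 // ltr0n gdist_gt0.
rewrite /F; lra.
Qed.

Lemma weakly_peakless_of_convex p f : weakly_convex p f ->
  @weakly_peakless R G p f.
Proof.
move=> cf u v; have [q [gq cq]] := cf u v; exists q; split=> //.
move=> i j k ij jk kq; have := cq i j k ij jk kq.
have [gs _] := gq.
have [e1 d1] :=
  geodesic_string_nth gs (introT andP (conj ij (ltn_trans jk kq))).
have [e2 d2] :=
  geodesic_string_nth gs (introT andP (conj jk kq)).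
have [e3 d3] :=
  geodesic_string_nth gs (introT andP (conj (ltn_trans ij jk) kq)).
set w := nth u (u :: q) in e1 d1 e2 d2 e3 d3 *.
have -> : gdist (w i) (w k) = (gdist (w i) (w j) + gdist (w j) (w k))%N by lia.
rewrite (gdist_sym (w k)).
set a := gdist (w i) (w j) in d1 *; set b := gdist (w j) (w k) in d2 *.
have a0 : 0 < a%:R :> R by rewrite ltr0n.
have b0 : 0 < b%:R :> R by rewrite ltr0n.
rewrite -[_ * f (w i)]mulrAC -[_ * f (w k)]mulrAC -mulrDl.
rewrite ler_pdivlMr natrD ?addr_gt0 // => cvx.
case: (leP (f (w i)) (f (w k))) => le_ik; split=> [|e]; try split; nra.
Qed.

(** Where [f] is peakless it nowhere exceeds the larger of its values at the ends,
and a p-geodesic has an interior vertex when its ends are at distance more than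
[p]. *)
Lemma p_isometric_of_peakless p f alpha : weakly_peakless p f ->
  @p_isometric G p (@level_set R G f alpha).
Proof.
move=> pf u v fu fv puv; have [q [gq pq]] := pf u v.
have [j [/andP[j0 jq] ouv]] := p_geodesic_interior gq puv.
exists (nth u (u :: q) j); split=> //.
have [+ _] := pq 0%N j (size q) j0 jq (leqnn _).
rewrite (nth_geodesic_last (proj1 gq)) => /le_trans; apply.
by rewrite ge_max fu.
Qed.

Lemma Med_level_set pi x : Med pi x ->
  Med pi = level_set (median_fun pi) (median_fun pi x).
Proof.
move=> xM; apply/seteqP; split=> y; first by move=> yM; exact: yM.
by move=> yx z; exact: le_trans yx (xM z).
Qed.

End MedianFunction.

(** * Convexity along concatenated geodesics *)

Section Convexity.
Local Open Scope classical_set_scope.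
Local Open Scope ring_scope.
Variables (R : realType) (G : connected_graph).
Implicit Types (f pi : G -> R) (u v w x y z : G) (s q : seq G).

Lemma convex_onP f u v q : geodesic_string u v q ->
  let w := nth u (u :: q) in
  convex_on f u q <->
  forall i j k, (i < j)%N -> (j < k)%N -> (k < size (u :: q))%N ->
    (gdist (w i) (w k))%:R * f (w j) <=
      (gdist (w j) (w k))%:R * f (w i) + (gdist (w i) (w j))%:R * f (w k).
Proof.
move=> gs w.
have E i j k : (i < j)%N -> (j < k)%N -> (k < size (u :: q))%N ->
    (f (w j) <= (gdist (w k) (w j))%:R / (gdist (w i) (w k))%:R * f (w i) +
                (gdist (w i) (w j))%:R / (gdist (w i) (w k))%:R * f (w k)) =
    ((gdist (w i) (w k))%:R * f (w j) <=
      (gdist (w j) (w k))%:R * f (w i) + (gdist (w i) (w j))%:R * f (w k)).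
  move=> ij jk kq; have [|_] := geodesic_string_nth gs (i := i) (j := k).
    by rewrite (ltn_trans ij jk).
  rewrite -/w -(ltr0n R) => ik0; rewrite (gdist_sym (w k)).
  rewrite -[_ / _ * f (w i)]mulrAC -[_ / _ * f (w k)]mulrAC -mulrDl.
  by rewrite ler_pdivlMr // mulrC.
split=> cq; first by move=> i j k ij jk kq; rewrite -E //; exact: cq.
by move=> i j k ij jk kq; rewrite E //; exact: cq.
Qed.

(** The height of [f] at [x] above the chord between [(u, f u)] and [(v, f v)],
multiplied by the length of the chord to avoid divisions. *)
Definition chord_gap f u v x : R :=
  (gdist u v)%:R * f x - (gdist x v)%:R * f u - (gdist u x)%:R * f v.

(** Convexity on [a < b < m] extends to [a < b < m < c] when the value at [m] is
a minimum: then the chord from [a] to [m] lies below the chord from [a] to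
[c]. *)
Lemma convex_join (a b m c ha hb hm hc : R) : a < b -> b < m -> m < c ->
  (m - a) * hb <= (m - b) * ha + (b - a) * hm -> hm <= ha -> hm <= hc ->
  (c - a) * hb <= (c - b) * ha + (b - a) * hc.
Proof.
move=> ab bm mc cvx hma hmc.
have ma : 0 < m - a by lra.
rewrite -(ler_pM2l ma).
have h1 : 0 <= (c - a) * ((m - b) * ha + (b - a) * hm - (m - a) * hb).
  by apply: mulr_ge0; lra.
have h2 : 0 <= (m - a) * (b - a) * (hc - hm).
  by apply: mulr_ge0; [apply: mulr_ge0|]; lra.
have h3 : 0 <= (b - a) * (c - m) * (ha - hm).
  by apply: mulr_ge0; [apply: mulr_ge0|]; lra.
by lra.
Qed.

(** Induction on the distance.  Convexity of [f] and of its height above the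
chord from [u] to [v] are the same; the two pieces supplied by the induction
hypothesis meet at a minimum of the height, so no triple around the junction can
fail. *)
Lemma weakly_convex_of_min p f :
  (forall u v, (p < gdist u v)%N -> exists w,
     [/\ open_interval u v w, chord_gap f u v w <= 0 &
         forall x, open_interval u v x ->
           chord_gap f u v w <= chord_gap f u v x]) ->
  weakly_convex p f.
Proof.
move=> minf u v; have [n] := ubnP (gdist u v); elim: n u v => // n IHn u v uvn.
have [uvp|puv] := leqP (gdist u v) p.
  have [q [gq q1]] := p_geodesic_short uvp; exists q; split=> // i j k ij jk kq.
  by move: kq => /=; lia.
have [w [ouvw gap0 gapw]] := minf u v puv.
have [wuv uw wv] := (open_intervalP _ _ _).1 ouvw.
have [|q1 [g1 c1]] := IHn u w; first by lia.
have [|q2 [g2 c2]] := IHn w v; first by lia.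
have gq := p_geodesic_cat wuv g1 g2.
exists (q1 ++ q2); split=> //.
have [[gs1 _] [gs2 _] [gs _]] := And3 g1 g2 gq.
apply/(convex_onP f gs); set W := nth u (u :: q1 ++ q2); set m := size q1.
have W1 i : (i <= m)%N -> W i = nth u (u :: q1) i.
  by move=> im; rewrite /W -cat_cons nth_cat /= ltnS im.
have Wm : W m = w by rewrite W1 // (nth_geodesic_last gs1).
have W2 i : (m <= i < size (u :: q1 ++ q2))%N -> W i = nth w (w :: q2) (i - m).
  rewrite leq_eqVlt => /andP[/predU1P[<- _|mi iq]]; first by rewrite subnn.
  rewrite /W -cat_cons nth_cat /= ltnS leqNgt mi /=.
  rewrite -[(i - m)%N]prednK ?subn_gt0 //= subnS; apply: set_nth_default.
  by move: iq; rewrite /= size_cat -/m; lia.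
pose t i : R := (gdist u (W i))%:R.
have tW i j : (i < j)%N -> (j < size (u :: q1 ++ q2))%N ->
    (gdist (W i) (W j))%:R = t j - t i /\ t i < t j.
  move=> ij jq; have [|e1 e2] := geodesic_string_nth gs (i := i) (j := j).
    by rewrite ij.
  rewrite -!/W in e1 e2; rewrite /t -e1 natrD ltrDl ltr0n; split=> //.
  by ring.
pose h i := chord_gap f u v (W i).
have hE i : (i < size (u :: q1 ++ q2))%N ->
    h i = (gdist u v)%:R * f (W i) - ((gdist u v)%:R - t i) * f u - t i * f v.
  move=> iq; rewrite /h /chord_gap; have := geodesic_string_interval gs iq.
  by rewrite -/W => <-; rewrite natrD /t; ring.
have hmin i : (i < size (u :: q1 ++ q2))%N -> h m <= h i.
  move=> iq; have := geodesic_string_interval gs iq; rewrite -/W => iuv.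
  rewrite {1}/h Wm /h.
  case: (geo_interval_cases iuv) => [->|->|]; last exact: gapw.
    by apply: (le_trans gap0); rewrite /chord_gap gdistxx; lra.
  by apply: (le_trans gap0); rewrite /chord_gap gdistxx; lra.
have n0 : 0 < (gdist u v)%:R :> R by rewrite ltr0n; lia.
(* Subtracting an affine function of the position and scaling by the positive
   length do not affect convexity. *)
have cvxE i j k : (i < j)%N -> (j < k)%N -> (k < size (u :: q1 ++ q2))%N ->
    ((gdist (W i) (W k))%:R * f (W j) <=
      (gdist (W j) (W k))%:R * f (W i) + (gdist (W i) (W j))%:R * f (W k)) =
    ((t k - t i) * h j <= (t k - t j) * h i + (t j - t i) * h k).
  move=> ij jk kq; have jq := ltn_trans jk kq.
  rewrite (tW i k (ltn_trans ij jk) kq).1 (tW j k jk kq).1 (tW i j ij jq).1.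
  rewrite !hE ?(ltn_trans ij jq) // -(ler_pM2l n0) -subr_ge0 -[RHS]subr_ge0.
  by congr (0 <= _); ring.
move=> i j k ij jk kq; have jq := ltn_trans jk kq; have iq := ltn_trans ij jq.
rewrite cvxE //.
have cl a b c : (a < b)%N -> (b < c)%N -> (c <= m)%N ->
    (t c - t a) * h b <= (t c - t b) * h a + (t b - t a) * h c.
  move=> ab bc cm; rewrite -cvxE //; last by rewrite /= size_cat -/m; lia.
  rewrite !W1; [|lia..]; exact: (convex_onP f gs1).1.
have cr a b c : (a < b)%N -> (b < c)%N -> (m <= a)%N ->
    (c < size (u :: q1 ++ q2))%N ->
    (t c - t a) * h b <= (t c - t b) * h a + (t b - t a) * h c.
  move=> ab bc ma cq; rewrite -cvxE //.
  rewrite !W2; [|lia..]; apply: (convex_onP f gs2).1 => //; try lia.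
  by move: cq; rewrite /= size_cat -/m; lia.
have [km|mk] := leqP k m; first exact: cl.
have [mi|im] := leqP m i; first exact: cr.
have mq := ltn_trans mk kq.
have [_ tij] := tW i j ij jq; have [_ tjk] := tW j k jk kq.
have [_ tim] := tW i m im mq; have [_ tmk] := tW m k mk kq.
have hi := hmin i iq; have hk := hmin k kq.
case: (ltngtP j m) => [jm|mj|jm].
- have [_ tjm] := tW j m jm mq.
  exact: convex_join (cl i j m ij jm (leqnn _)) hi hk.
- have [_ tmj] := tW m j mj jq.
  (* The mirror image of the previous case. *)
  have := @convex_join (- t k) (- t j) (- t m) (- t i) (h k) (h j) (h m) (h i).
  have := cr m j k mj jk (leqnn _) kq; lra.
- rewrite -jm in hi hk.
  have h1 : 0 <= (t k - t j) * (h i - h j).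
    by apply: mulr_ge0; lra.
  have h2 : 0 <= (t j - t i) * (h k - h j).
    by apply: mulr_ge0; lra.
  lra.
Qed.

End Convexity.

(** * From integer profiles to convexity *)

Section Rounding.
Local Open Scope classical_set_scope.
Local Open Scope ring_scope.
Variables (R : realType) (G : connected_graph).
Implicit Types (f pi : G -> R) (u v w x y z : G) (s q : seq G).

Lemma chord_gap_attains_min pi u v : profile pi -> (1 < gdist u v)%N ->
  exists2 w, open_interval u v w & forall x, open_interval u v x ->
    chord_gap (median_fun pi) u v w <= chord_gap (median_fun pi) u v x.
Proof.
move=> pp uv; have [s sF] := median_fun_local pp.
apply: (attains_min (s := u :: v :: s) (x0 := u) (B := gdist u v)); last first.
- exact: open_interval_nonempty.
- by move=> x /open_intervalP[<- _ _]; exact: leq_addr.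
move=> x y xy; rewrite /chord_gap (sF x y) => [|z zs]; last first.
  by apply: xy; rewrite !inE zs !orbT.
by rewrite (gdist_sym x) (gdist_sym y) !xy // !inE eqxx ?orbT.
Qed.

(** Scaling by [N] multiplies the lower bound [eps] by [N], whereas the effect
of rounding on the gap stays bounded as [N] grows. *)
Lemma integer_profile_chord_gap pi u v (eps K : R) : profile pi -> 0 < eps ->
  (forall x, open_interval u v x -> eps <= chord_gap (median_fun pi) u v x) ->
  exists2 sigma : G -> R, integer_profile sigma &
    forall x, open_interval u v x -> K <= chord_gap (median_fun sigma) u v x.
Proof.
move=> pp eps0 gapx.
have [C rnd] := median_fun_round u (gdist u v) pp.
pose n : R := (gdist u v)%:R.
pose N := (Num.truncn ((K + n * C) / eps)).+1.
exists (round_profile N pi); first exact: integer_round_profile.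
move=> x ox; have [xuv _ _] := (open_intervalP _ _ _).1 ox.
have /andP[lex _] := rnd N x (leq_trans (leq_addr _ _) (eq_leq xuv)).
have /andP[_ leu] := rnd N u (eq_ind_r (leq^~ _) (leq0n _) (gdistxx u)).
have /andP[_ lev] := rnd N v (leqnn _).
have leK : K + n * C <= N%:R * eps.
  by rewrite -ler_pdivrMr // ltW // truncnS_gt.
have leg : N%:R * eps <= N%:R * chord_gap (median_fun pi) u v x.
  by rewrite ler_wpM2l // gapx.
have n0 : 0 <= n by [].
have := ler_wpM2l n0 lex.
have := ler_wpM2l (ler0n R (gdist x v)) leu.
have := ler_wpM2l (ler0n R (gdist u x)) lev.
move: leg; rewrite /chord_gap -/n; lra.
Qed.

Lemma integer_profile_add_mass pi v (a : nat) : integer_profile pi ->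
  integer_profile (add_mass pi v a%:R).
Proof.
move=> [pp pint]; split=> [|x]; first exact: profile_add_mass.
by rewrite rpredD // rpredMn // natr_nat.
Qed.

(** The masses are [M + a] at [u] and [M + b] at [v].  The difference of [a] and
[b] brings the value at [v] below the value at [u], by less than [2 * n] with
[n] the distance of [u] and [v].  Seen from [u] the chord then descends by at
most [2 * n], which a gap of [2 * n ^ 2] (scaled by [n]) makes up for.  A large
[M] handles the vertices outside the interval, where the two distances add up to
at least [n + 1]. *)
Lemma local_median_of_chord_gap p pi u v : integer_profile pi ->
  (p < gdist u v)%N ->
  (forall x, open_interval u v x ->
    2 * (gdist u v)%:R ^+ 2 <= chord_gap (median_fun pi) u v x) ->
  exists2 sigma : G -> R, integer_profile sigma &
    Med_loc p sigma u /\ ~ Med sigma u.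
Proof.
move=> [pp pint] puv gapx.
pose F := median_fun pi; pose n : R := (gdist u v)%:R.
have n1 : 1 <= n by rewrite ler1n; lia.
have Fge0 x : 0 <= F x := median_fun_ge0 x pp.
have nat_above (x : R) : exists m : nat, x <= m%:R.
  by exists (Num.truncn x).+1; rewrite ltW // truncnS_gt.
have [b leb] := nat_above (F v + 1).
have lebn : (F v + 1) * n <= b%:R * n by rewrite ler_wpM2r.
have Fvn : F v <= F v * n by rewrite ler_peMr.
(* [Y / n] truncates to the mass that leaves the value at [v] between [n] and
   [2 * n] below the value at [u]. *)
pose Y := F u + b%:R * n - F v - n.
have Y0 : 0 <= Y / n.
  by rewrite divr_ge0 //; rewrite /Y; have := Fge0 u; lra.
have [a [leaY ltYa]] : exists a : nat, a%:R * n <= Y /\ Y < a%:R * n + n.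
  exists (Num.truncn (Y / n)); have /andP[] := truncn_itv Y0.
  by rewrite -natr1 ler_pdivlMr ?ltr_pdivrMr ?mulrDl ?mul1r //; lra.
have [M leM] := nat_above (F u + b%:R * n).
have pp1 := @integer_profile_add_mass pi u (M + a) (conj pp pint).
exists (add_mass (add_mass pi u (M + a)%:R) v (M + b)%:R).
  exact: integer_profile_add_mass.
have FE x : median_fun (add_mass (add_mass pi u (M + a)%:R) v (M + b)%:R) x =
    F x + (M%:R + a%:R) * (gdist u x)%:R + (M%:R + b%:R) * (gdist v x)%:R.
  by rewrite !median_fun_add_mass //; [rewrite !natrD | exact: pp1.1].
have F'u := FE u; rewrite gdistxx mulr0 addr0 (gdist_sym v u) -/n in F'u.
split=> [x xp|]; last first.
  move=> /(_ v); rewrite F'u FE gdistxx mulr0 addr0 -/n.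
  by rewrite /Y in leaY; lra.
rewrite F'u FE (gdist_sym v x).
have [xuv|xNuv] := eqVneq (gdist u x + gdist x v)%N (gdist u v); last first.
  have : n + 1 <= (gdist u x)%:R + (gdist x v)%:R.
    rewrite /n natr1 -natrD ler_nat; have := gdist_triangle x u v; lia.
  set d1 := (gdist u x)%:R; set d2 := (gdist x v)%:R => far.
  have d10 : 0 <= d1 by []. have d20 : 0 <= d2 by [].
  have h1 := ler_wpM2l (ler0n R M) far.
  have h2 := mulr_ge0 (ler0n R a) d10; have h3 := mulr_ge0 (ler0n R b) d20.
  by have := Fge0 x; lra.
case: (geo_interval_cases xuv) => [->|xv|ox]; last 1 first.
- have := gapx x ox; rewrite /chord_gap -/n -/F.
  have nE : n = (gdist u x)%:R + (gdist x v)%:R by rewrite -natrD xuv.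
  move: nE; set t := (gdist u x)%:R; set r := (gdist x v)%:R => nE gap.
  have t0 : 0 <= t by []. have r0 : 0 <= r by [].
  have n0 : 0 < n by lra.
  rewrite -(ler_pM2l n0).
  (* The parenthesis is [2 * n] minus the total descent of the chord. *)
  have h1 : 0 <= t * (2 * n - (F u + b%:R * n - F v - a%:R * n)).
    by rewrite mulr_ge0 //; rewrite /Y in ltYa; lra.
  have h2 : 0 <= 2 * n * r by rewrite mulr_ge0 //; lra.
  by rewrite nE in gap h1 h2 *; lra.
- by rewrite gdistxx mulr0 addr0.
by move: xp; rewrite xv leqNgt puv.
Qed.

Lemma weakly_convex_of_local p : (1 <= p)%N ->
  (forall pi, integer_profile pi -> Med_loc p pi = Med pi) ->
  forall pi, profile pi -> weakly_convex p (@median_fun R G pi).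
Proof.
move=> p1 loc pi pp; apply: weakly_convex_of_min => u v puv.
have [w ow minw] := chord_gap_attains_min pp (leq_ltn_trans p1 puv).
exists w; split=> //; rewrite leNgt; apply/negP => gap0.
have [sigma si gs] :=
  integer_profile_chord_gap (2 * (gdist u v)%:R ^+ 2) pp gap0 minw.
have [tau ti [locu Nu]] := local_median_of_chord_gap si puv gs.
by apply: Nu; rewrite -loc.
Qed.

End Rounding.

Theorem theorem18 (R : realType) (G : connected_graph) (p : nat)
    (hp : (1 <= p)%N) :
  [<-> (* (1) *) forall pi : G -> R, integer_profile pi ->
         Med_loc p pi = Med pi;
       (* (2) *) forall pi : G -> R, profile pi -> Med_loc p pi = Med pi;
       (* (3) *) forall pi : G -> R, profile pi ->
         weakly_convex p (median_fun pi);
       (* (4) *) forall pi : G -> R, profile pi ->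
         weakly_peakless p (median_fun pi);
       (* (5) *) forall pi : G -> R, profile pi ->
         forall alpha : R, p_isometric p (level_set (median_fun pi) alpha);
       (* (6) *) forall pi : G -> R, profile pi -> p_isometric p (Med pi);
       (* (7) *) forall pi : G -> R, profile pi ->
         connected_in (@power_adj G p) (Med pi)].
Proof.
have c13 := @weakly_convex_of_local R G p hp.
have c34 : (forall pi : G -> R, profile pi ->
      weakly_convex p (median_fun pi)) ->
    forall pi : G -> R, profile pi -> weakly_peakless p (median_fun pi).
  by move=> c pi /c; exact: weakly_peakless_of_convex.
have c45 : (forall pi : G -> R, profile pi ->
      weakly_peakless p (median_fun pi)) ->
    forall pi : G -> R, profile pi ->
    forall alpha : R, p_isometric p (level_set (median_fun pi) alpha).
  by move=> c pi /c cpi alpha; exact: p_isometric_of_peakless.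
have c56 : (forall pi : G -> R, profile pi ->
      forall alpha : R, p_isometric p (level_set (median_fun pi) alpha)) ->
    forall pi : G -> R, profile pi -> p_isometric p (Med pi).
  move=> c pi /c cpi x y Mx; have ME := Med_level_set Mx.
  by move: Mx; rewrite ME; exact: cpi.
have c67 : (forall pi : G -> R, profile pi -> p_isometric p (Med pi)) ->
    forall pi : G -> R, profile pi -> connected_in (@power_adj G p) (Med pi).
  by move=> c pi /c; exact: p_isometric_connected.
have c72 := @Med_loc_eq_of_connected R G p.
tfae=> //.
- by move=> /c13/c34/c45/c56/c67; exact: c72.
- by move=> c; apply: c13 => pi [pp _]; exact: c.
- by move=> /c72 c pi [pp _]; exact: c.
Qed.
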